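(* Let $(A,\cdot,\{~,~\})$ be an $F$-manifold algebra and $N:A\to A$ be a Nijenhuis operator on it. Then $(A,\ast,\curlyvee,\diamond,\bullet)$ is an NS-$F$-manifold algebra, where $$x\ast y=N(x)\cdot y,\quad x\curlyvee y=-N(x\cdot y),\quad x\diamond y=\{N(x),y\},\quad x\bullet y=-N\{x,y\},\qquad x,y\in A.$$
   Context: All vector spaces and (multi)linear maps are over a field $\mathbf{k}$ of characteristic $0$. Associative algebras are not required to be unital. An $F$-manifold algebra is a triple $(A,\cdot,\{~,~\})$ with $(A,\cdot)$ a commutative associative algebra, $(A,\{~,~\})$ a Lie algebra, and $P_{x\cdot y}(z,w)=x\cdot P_y(z,w)+y\cdot P_x(z,w)$ for all $x,y,z,w\in A$, where $P_x(y,z)=\{x,y\cdot z\}-\{x,y\}\cdot z-y\cdot\{x,z\}$. A Nijenhuis operator on an $F$-manifold algebra $(A,\cdot,\{~,~\})$ is a linear map $N:A\to A$ such that for all $x,y\in A$: $$N(x)\cdot N(y)=N\big(N(x)\cdot y+x\cdot N(y)-N(x\cdot y)\big),\qquad \{N(x),N(y)\}=N\big(\{N(x),y\}+\{x,N(y)\}-N\{x,y\}\big).$$ An NS-commutative algebra is a triple $(A,\ast,\curlyvee)$ of a vector space $A$ with bilinear operations $\ast,\curlyvee$, where $\curlyvee$ is commutative, such that for all $x,y,z\in A$, with $x\odot y=x\ast y+y\ast x+x\curlyvee y$: $$x\ast(y\ast z)=(x\odot y)\ast z,\qquad x\ast(y\curlyvee z)+x\curlyvee(y\odot z)=y\ast(x\curlyvee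 z)+y\curlyvee(x\odot z).$$ An NS-Lie algebra is a triple $(A,\diamond,\bullet)$ of a vector space $A$ with bilinear operations $\diamond,\bullet$, where $\bullet$ is skew-symmetric, such that for all $x,y,z\in A$, with $\{\!\!\{x,y\}\!\!\}=x\diamond y-y\diamond x+x\bullet y$: $$x\diamond(y\diamond z)-(x\diamond y)\diamond z-y\diamond(x\diamond z)+(y\diamond x)\diamond z=(x\bullet y)\diamond z,$$ $$x\bullet\{\!\!\{y,z\}\!\!\}+y\bullet\{\!\!\{z,x\}\!\!\}+z\bullet\{\!\!\{x,y\}\!\!\}+x\diamond(y\bullet z)+y\diamond(z\bullet x)+z\diamond(x\bullet y)=0.$$ An NS-$F$-manifold algebra is a quintuple $(A,\ast,\curlyvee,\diamond,\bullet)$ such that $(A,\ast,\curlyvee)$ is an NS-commutative algebra, $(A,\diamond,\bullet)$ is an NS-Lie algebra, and for all $x,y,z,w\in A$: $$F_1(x\odot y,z,w)=x\ast F_1(y,z,w)+y\ast F_1(x,z,w),$$ $$\big(F_1(x,y,z)+F_1(x,z,y)+F_2(y,z,x)+F_3(x,y,z)\big)\ast w=F_2(y,z,x\ast w)-x\ast F_2(y,z,w),$$ $$F_3(x\odot y,z,w)+F_2(z,w,y\curlyvee x)=x\ast F_3(y,z,w)+y\ast F_3(x,z,w)+x\curlyvee\big(F_1(y,z,w)+F_1(y,w,z)+F_2(z,w,y)+F_3(y,z,w)\big)+y\curlyvee\big(F_1(x,z,w)+F_1(x,w,z)+F_2(z,w,x)+F_3(x,z,w)\big),$$ where $F_1,F_2,F_3:A^{\otimes3}\to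 A$ are $$F_1(x,y,z)=x\diamond(y\ast z)-y\ast(x\diamond z)-\{\!\!\{x,y\}\!\!\}\ast z,$$ $$F_2(x,y,z)=x\ast(y\diamond z)+y\ast(x\diamond z)-(x\odot y)\diamond z,$$ $$F_3(x,y,z)=x\bullet(y\odot z)+x\diamond(y\curlyvee z)-z\ast(x\bullet y)-y\ast(x\bullet z)-y\curlyvee\{\!\!\{x,z\}\!\!\}-\{\!\!\{x,y\}\!\!\}\curlyvee z.$$ *)

(* Defs.v *)
From mathcomp Require Import all_boot all_order all_algebra.

Set Implicit Arguments.
Unset Strict Implicit.
Unset Printing Implicit Defensive.

Import GRing.Theory.
Local Open Scope ring_scope.

(* Algebra structures are predicates on plain binary operations over a module,
   rather than on MathComp rings: the algebras need not be unital. *)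

Definition bilinear_op (k : fieldType) (A : lmodType k) (f : A -> A -> A) :=
  bilinear_for ( *:%R : k -> A -> A) ( *:%R : k -> A -> A) f.

Section FManifold.
Variables (k : fieldType) (A : lmodType k).

Record comm_assoc_algebra (mul : A -> A -> A) : Prop := CommAssocAlgebra {
  caa_bilinear : bilinear_op mul;
  caa_comm : commutative mul;
  caa_assoc : associative mul
}.

Record Lie_algebra (br : A -> A -> A) : Prop := LieAlgebra {
  Lie_bilinear : bilinear_op br;
  Lie_alternating : forall x, br x x = 0;
  Lie_Jacobi : forall x y z,
    br x (br y z) + br y (br z x) + br z (br x y) = 0
}.

(* [Leibnizator mul br x y z] is P_x(y, z). *)
Definition Leibnizator (mul br : A -> A -> A) (x y z : A) : A :=
  br x (mul y z) - mul (br x y) z - mul y (br x z).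

Record F_manifold_algebra (mul br : A -> A -> A) : Prop := FManifoldAlgebra {
  Fma_comm_assoc : comm_assoc_algebra mul;
  Fma_Lie : Lie_algebra br;
  Fma_Hertling_Manin : forall x y z w,
    Leibnizator mul br (mul x y) z w =
      mul x (Leibnizator mul br y z w) + mul y (Leibnizator mul br x z w)
}.

Record Nijenhuis_operator (mul br : A -> A -> A) (N : A -> A) : Prop :=
  NijenhuisOperator {
    Nij_linear : linear N;
    Nij_mul : forall x y,
      mul (N x) (N y) = N (mul (N x) y + mul x (N y) - N (mul x y));
    Nij_br : forall x y,
      br (N x) (N y) = N (br (N x) y + br x (N y) - N (br x y))
  }.

End FManifold.

Section NSFManifold.
Variables (k : fieldType) (A : lmodType k).

(* In this section [ast], [vee], [dia], [bul] stand for the operations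
   *, \curlyvee, \diamond, \bullet. *)

(* x \odot y *)
Definition NS_odot (ast vee : A -> A -> A) (x y : A) : A :=
  ast x y + ast y x + vee x y.

(* {{x, y}} *)
Definition NS_bracket (dia bul : A -> A -> A) (x y : A) : A :=
  dia x y - dia y x + bul x y.

Record NS_commutative_algebra (ast vee : A -> A -> A) : Prop :=
  NSCommutativeAlgebra {
    NSC_ast_bilinear : bilinear_op ast;
    NSC_vee_bilinear : bilinear_op vee;
    NSC_vee_comm : commutative vee;
    NSC_ast_ast : forall x y z,
      ast x (ast y z) = ast (NS_odot ast vee x y) z;
    NSC_ast_vee : forall x y z,
      ast x (vee y z) + vee x (NS_odot ast vee y z) =
        ast y (vee x z) + vee y (NS_odot ast vee x z)
  }.

Record NS_Lie_algebra (dia bul : A -> A -> A) : Prop := NSLieAlgebra {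
  NSL_dia_bilinear : bilinear_op dia;
  NSL_bul_bilinear : bilinear_op bul;
  NSL_bul_skew : forall x y, bul x y = - bul y x;
  NSL_dia_dia : forall x y z,
    dia x (dia y z) - dia (dia x y) z - dia y (dia x z) + dia (dia y x) z =
      dia (bul x y) z;
  NSL_cyclic : forall x y z,
    bul x (NS_bracket dia bul y z) + bul y (NS_bracket dia bul z x)
      + bul z (NS_bracket dia bul x y)
      + dia x (bul y z) + dia y (bul z x) + dia z (bul x y) = 0
}.

Definition NS_F1 (ast vee dia bul : A -> A -> A) (x y z : A) : A :=
  dia x (ast y z) - ast y (dia x z) - ast (NS_bracket dia bul x y) z.

Definition NS_F2 (ast vee dia bul : A -> A -> A) (x y z : A) : A :=
  ast x (dia y z) + ast y (dia x z) - dia (NS_odot ast vee x y) z.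

Definition NS_F3 (ast vee dia bul : A -> A -> A) (x y z : A) : A :=
  bul x (NS_odot ast vee y z) + dia x (vee y z)
    - ast z (bul x y) - ast y (bul x z)
    - vee y (NS_bracket dia bul x z) - vee (NS_bracket dia bul x y) z.

Record NS_F_manifold_algebra (ast vee dia bul : A -> A -> A) : Prop :=
  NSFManifoldAlgebra {
    NSF_commutative : NS_commutative_algebra ast vee;
    NSF_Lie : NS_Lie_algebra dia bul;
    NSF_F1 : forall x y z w,
      let F1 := NS_F1 ast vee dia bul in
      F1 (NS_odot ast vee x y) z w = ast x (F1 y z w) + ast y (F1 x z w);
    NSF_F2 : forall x y z w,
      let F1 := NS_F1 ast vee dia bul in
      let F2 := NS_F2 ast vee dia bul in
      let F3 := NS_F3 ast vee dia bul in
      ast (F1 x y z + F1 x z y + F2 y z x + F3 x y z) w =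
        F2 y z (ast x w) - ast x (F2 y z w);
    NSF_F3 : forall x y z w,
      let F1 := NS_F1 ast vee dia bul in
      let F2 := NS_F2 ast vee dia bul in
      let F3 := NS_F3 ast vee dia bul in
      F3 (NS_odot ast vee x y) z w + F2 z w (vee y x) =
        ast x (F3 y z w) + ast y (F3 x z w)
        + vee x (F1 y z w + F1 y w z + F2 z w y + F3 y z w)
        + vee y (F1 x z w + F1 x w z + F2 z w x + F3 x z w)
  }.

End NSFManifold.

(* Main.v *)
Require Import Defs.
From mathcomp Require Import all_boot all_order all_algebra.
Import GRing.Theory.
Local Open Scope ring_scope.

(** The Nijenhuis identities say that N is a morphism from the deformed product
    x o y = N x . y + x . N y - N (x . y) and the deformed bracket {{x, y}} to
    the original operations, and these are precisely the operations \odot and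
    {{ , }} attached to the four NS operations of the theorem.

    For the NS-commutative and NS-Lie axioms, a product N x . N u with u itself
    a product is replaced by N (x o u); associativity or the Jacobi identity,
    with N inserted in some of the arguments, does the rest.

    For the compatibility axioms everything is written with the Leibnizator P
    of the original algebra:
      F1 (x, y, z) = P_(N x) (N y, z),      F2 (x, y, z) = P_z (N x, N y),
      F3 (x, y, z) = - N (D (x, y, z)),
    where D (x, y, z) = P_(N x) (y, z) + P_x (N y, z) + P_x (y, N z)
                        - N (P_x (y, z)).
    The sum S = F1 (x, y, z) + F1 (x, z, y) + F2 (y, z, x) + F3 (x, y, z) turns
    out to be the Leibnizator of the deformed operations, so that
    N S = P_(N x) (N y, N z); this is [Leibnizator_Nijenhuis].  The first two
    axioms are then instances of the Hertling-Manin relation.  In the third one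
    both sides are images under N; expanding them with the Nijenhuis identity
    and [Leibnizator_Nijenhuis] leaves Hertling-Manin relations with N inserted
    in zero, one or two of the four arguments. *)

(* Solves an equation between sums in an abelian group: everything is moved to
   one side, and the last term is repeatedly carried leftwards until it meets
   its opposite. *)
Ltac cancel_in s t :=
  lazymatch constr:((s, t)) with
  | (?s' + ?a, - ?a) => rewrite (addrK a s')
  | (?s' - ?a, ?a) => rewrite (subrK a s')
  | (?s' + ?y, _) => rewrite (addrAC s' y t); cancel_in s' t
  | (?a, - ?a) => rewrite (subrr a) ?add0r
  | (- ?a, ?a) => rewrite (addNr a) ?add0r
  end.

Ltac abelian :=
  apply/eqP; rewrite -subr_eq0; apply/eqP;
  rewrite ?(opprD, opprK, oppr0, addr0, add0r, addrA);
  repeat lazymatch goal with |- ?s + ?t = 0 => cancel_in s t end;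
  reflexivity.

Section NijenhuisFManifold.
Context {k : fieldType} {A : lmodType k} {mul br : A -> A -> A} {N : A -> A}.
Hypothesis hA : F_manifold_algebra mul br.
Hypothesis hN : Nijenhuis_operator mul br N.

Local Notation P := (Leibnizator mul br).
Local Notation ast := (fun x y => mul (N x) y).
Local Notation vee := (fun x y => - N (mul x y)).
Local Notation dia := (fun x y => br (N x) y).
Local Notation bul := (fun x y => - N (br x y)).

Let mul_bil : bilinear_op mul := caa_bilinear (Fma_comm_assoc hA).
Let br_bil : bilinear_op br := Lie_bilinear (Fma_Lie hA).

Lemma bilinear_opDl (f : A -> A -> A) :
  bilinear_op f -> forall x y z, f (x + y) z = f x z + f y z.
Proof.
case=> fl _ x y z.
have := fl z 1 x y : f (1 *: x + y) z = 1 *: f x z + f y z.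
by rewrite !scale1r.
Qed.

Lemma bilinear_opDr (f : A -> A -> A) :
  bilinear_op f -> forall x y z, f z (x + y) = f z x + f z y.
Proof.
case=> _ fr x y z.
have := fr z 1 x y : f z (1 *: x + y) = 1 *: f z x + f z y.
by rewrite !scale1r.
Qed.

Lemma additiveN {V W : zmodType} (f : V -> W) :
  {morph f : x y / x + y} -> {morph f : x / - x}.
Proof.
move=> fD x; have f0 : f 0 = 0 by apply: (addrI (f 0)); rewrite -fD !addr0.
by apply/eqP; rewrite -addr_eq0 -fD addNr f0.
Qed.

Lemma mulDl x y z : mul (x + y) z = mul x z + mul y z.
Proof. exact: bilinear_opDl mul_bil x y z. Qed.
Lemma mulDr x y z : mul z (x + y) = mul z x + mul z y.
Proof. exact: bilinear_opDr mul_bil x y z. Qed.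
Lemma mulNl x y : mul (- x) y = - mul x y.
Proof. by apply: (additiveN (mul^~ y)) => u v; exact: mulDl. Qed.
Lemma mulNr x y : mul x (- y) = - mul x y.
Proof. by apply: additiveN => u v; exact: mulDr. Qed.
Lemma mulC x y : mul x y = mul y x.
Proof. exact: caa_comm (Fma_comm_assoc hA) x y. Qed.
Lemma mulA x y z : mul x (mul y z) = mul (mul x y) z.
Proof. exact: caa_assoc (Fma_comm_assoc hA) x y z. Qed.

Lemma brDl x y z : br (x + y) z = br x z + br y z.
Proof. exact: bilinear_opDl br_bil x y z. Qed.
Lemma brDr x y z : br z (x + y) = br z x + br z y.
Proof. exact: bilinear_opDr br_bil x y z. Qed.
Lemma brNl x y : br (- x) y = - br x y.
Proof. by apply: (@additiveN _ _ (br^~ y)) => u v; exact: brDl. Qed.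
Lemma brNr x y : br x (- y) = - br x y.
Proof. by apply: additiveN => u v; exact: brDr. Qed.

Lemma br_skew x y : br x y = - br y x.
Proof.
have brxx := Lie_alternating (Fma_Lie hA).
apply/eqP; rewrite -addr_eq0; apply/eqP; move: (brxx (x + y)).
by rewrite brDl !brDr !brxx add0r addr0.
Qed.

Lemma br_derivation x y z : br (br x y) z = br x (br y z) - br y (br x z).
Proof.
have := Lie_Jacobi (Fma_Lie hA) x y z.
rewrite (br_skew z x) brNr (br_skew z) => /eqP.
by rewrite subr_eq0 => /eqP <-.
Qed.

Lemma NijD x y : N (x + y) = N x + N y.
Proof.
have := Nij_linear hN 1 x y : N (1 *: x + y) = 1 *: N x + N y.
by rewrite !scale1r.
Qed.
Lemma NijN x : N (- x) = - N x.
Proof. by apply: additiveN => u v; exact: NijD. Qed.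

Definition expand := (mulDl, mulDr, mulNl, mulNr, brDl, brDr, brNl, brNr,
  NijD, NijN, @opprK A).

Lemma bilinear_op_comp_Nl (f : A -> A -> A) :
  bilinear_op f -> bilinear_op (fun x y => f (N x) y).
Proof.
case=> fl fr; split=> u a x y; last exact: fr.
by rewrite /= (Nij_linear hN); exact: fl.
Qed.

Lemma bilinear_op_opp_comp_N (f : A -> A -> A) :
  bilinear_op f -> bilinear_op (fun x y => - N (f x y)).
Proof.
case=> fl fr; split=> u a x y /=.
  by rewrite (fl u a x y) (Nij_linear hN) opprD -scalerN.
by rewrite (fr u a x y) (Nij_linear hN) opprD -scalerN.
Qed.

Lemma N_odot x y : N (NS_odot ast vee x y) = mul (N x) (N y).
Proof. by rewrite (Nij_mul hN) /NS_odot (mulC x (N y)). Qed.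

Lemma N_bracket x y : N (NS_bracket dia bul x y) = br (N x) (N y).
Proof. by rewrite (Nij_br hN) /NS_bracket (br_skew x (N y)). Qed.

Lemma Nijenhuis_NS_commutative : NS_commutative_algebra ast vee.
Proof.
split.
- exact: bilinear_op_comp_Nl.
- exact: bilinear_op_opp_comp_N.
- by move=> x y; rewrite mulC.
- by move=> x y z; rewrite N_odot mulA.
- move=> x y z.
  have CA u v w : mul u (mul v w) = mul v (mul u w).
    by rewrite mulA (mulC u) -mulA.
  rewrite /NS_odot !expand !(Nij_mul hN) !expand.
  rewrite (CA y (N x) z) (CA y x z) (CA x (N y) z).
  rewrite (CA x (N z) y) (CA y (N z) x) (mulC y x).
  abelian.
Qed.

Lemma Nijenhuis_NS_Lie : NS_Lie_algebra dia bul.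
Proof.
split.
- exact: bilinear_op_comp_Nl.
- exact: bilinear_op_opp_comp_N.
- by move=> x y; rewrite br_skew NijN.
- move=> x y z.
  have := br_derivation (N x) (N y) z.
  rewrite -N_bracket /NS_bracket !expand => e.
  have -> : br (N x) (br (N y) z) = br (N (br (N x) y)) z
    - br (N (br (N y) x)) z - br (N (N (br x y))) z + br (N y) (br (N x) z).
    by rewrite e subrK.
  abelian.
- move=> x y z; have J := Lie_Jacobi (Fma_Lie hA).
  (* Four Jacobi sums: no N, then N in each one of the arguments. *)
  suff -> : bul x (NS_bracket dia bul y z) + bul y (NS_bracket dia bul z x)
      + bul z (NS_bracket dia bul x y)
      + dia x (bul y z) + dia y (bul z x) + dia z (bul x y)
    = N (N (br x (br y z) + br y (br z x) + br z (br x y)))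
      - N (br (N x) (br y z) + br y (br z (N x)) + br z (br (N x) y))
      - N (br x (br (N y) z) + br (N y) (br z x) + br z (br x (N y)))
      - N (br x (br y (N z)) + br y (br (N z) x) + br (N z) (br x y)).
    by rewrite !J -(subrr 0) !expand; abelian.
  rewrite /NS_bracket (br_skew (N z) y) (br_skew (N x) z) (br_skew (N y) x).
  rewrite !expand !(Nij_br hN) !expand (br_skew z (N x)) !expand.
  abelian.
Qed.

Lemma Leibnizator_sym x y z : P x y z = P x z y.
Proof.
by rewrite /Leibnizator (mulC y z) (mulC _ z) (mulC y) addrAC.
Qed.

Lemma LeibnizatorDl x y z w : P (x + y) z w = P x z w + P y z w.
Proof. by rewrite /Leibnizator !expand; abelian. Qed.

Lemma LeibnizatorNl x z w : P (- x) z w = - P x z w.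
Proof.
by apply: (@additiveN _ _ (fun u => P u z w)) => u v; exact: LeibnizatorDl.
Qed.

(** The coefficient of t in the Leibnizator of the operations x . y + t (x o y)
    and {x, y} + t {{x, y}}, which are the original ones transported along
    the formally invertible map 1 + t N. *)
Definition Leibnizator1 x y z : A :=
  P (N x) y z + P x (N y) z + P x y (N z) - N (P x y z).

Lemma NS_F1_Leibnizator x y z : NS_F1 ast vee dia bul x y z = P (N x) (N y) z.
Proof. by rewrite /NS_F1 N_bracket /Leibnizator addrAC. Qed.

Lemma NS_F2_Leibnizator x y z : NS_F2 ast vee dia bul x y z = P z (N x) (N y).
Proof.
rewrite /NS_F2 N_odot /Leibnizator.
rewrite (br_skew z) (br_skew z (N x)) (br_skew z (N y)) !expand.
rewrite (mulC (N y) (br (N x) z)).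
abelian.
Qed.

(** Every term of F3 is an image under N, by the Nijenhuis identities for those
    that are products or brackets of two such images. *)
Lemma NS_F3_Leibnizator x y z :
  NS_F3 ast vee dia bul x y z = - N (Leibnizator1 x y z).
Proof.
rewrite /NS_F3 /NS_odot /NS_bracket /Leibnizator1 /Leibnizator.
rewrite (br_skew (N z) x) (br_skew (N y) x) !expand.
rewrite (mulC (N z) (N _)) (mulC (N z) y) !(Nij_mul hN, Nij_br hN) !expand.
abelian.
Qed.

(** The Leibnizator itself satisfies a Nijenhuis identity, in three arguments:
    the argument of N on the right is the Leibnizator of the deformed
    operations, which N maps to the original ones. *)
Lemma Leibnizator_Nijenhuis x y z :
  P (N x) (N y) (N z) =
  N (P (N x) (N y) z + P (N x) y (N z) + P x (N y) (N z)
     - N (Leibnizator1 x y z)).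
Proof.
rewrite {1}/Leibnizator.
(* Each outer operation is expanded once; the inner products of two images of
   N are kept, since they occur as such in the Leibnizators on the right. *)
have -> : br (N x) (mul (N y) (N z)) =
    N (br (N x) (NS_odot ast vee y z) + br x (mul (N y) (N z))
       - N (br x (NS_odot ast vee y z))).
  by rewrite -N_odot (Nij_br hN).
have -> : mul (br (N x) (N y)) (N z) =
    N (mul (br (N x) (N y)) z + mul (NS_bracket dia bul x y) (N z)
       - N (mul (NS_bracket dia bul x y) z)).
  by rewrite -N_bracket (Nij_mul hN).
have -> : mul (N y) (br (N x) (N z)) =
    N (mul (N y) (NS_bracket dia bul x z) + mul y (br (N x) (N z))
       - N (mul y (NS_bracket dia bul x z))).
  by rewrite -N_bracket (Nij_mul hN).
rewrite -!NijN -!NijD; congr (N _).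
rewrite /NS_odot /NS_bracket /Leibnizator1 /Leibnizator.
rewrite (br_skew (N z) x) (br_skew (N y) x) (mulC (N z) y) !expand.
rewrite (Nij_br hN x (mul y z)) (Nij_mul hN (br x y) z).
rewrite (Nij_mul hN y (br x z)) !expand.
abelian.
Qed.

Lemma Nijenhuis_NS_F_manifold : NS_F_manifold_algebra ast vee dia bul.
Proof.
have HM := Fma_Hertling_Manin hA.
split.
- exact: Nijenhuis_NS_commutative.
- exact: Nijenhuis_NS_Lie.
- by move=> x y z w F1; rewrite /F1 !NS_F1_Leibnizator N_odot HM.
- move=> x y z w F1 F2 F3; rewrite /F1 /F2 /F3.
  rewrite !NS_F1_Leibnizator !NS_F2_Leibnizator NS_F3_Leibnizator.
  rewrite (Leibnizator_sym (N x) (N z)) -Leibnizator_Nijenhuis HM.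
  by rewrite addrAC subrr add0r mulC.
- move=> x y z w /=.
  rewrite !NS_F1_Leibnizator !NS_F2_Leibnizator !NS_F3_Leibnizator.
  rewrite !(Leibnizator_sym (N _) (N w) z) (mulC y x) LeibnizatorNl.
  rewrite Leibnizator_Nijenhuis /Leibnizator1 N_odot /NS_odot.
  (* Generalizing P keeps the distributivity rewrites from unfolding it. *)
  move: (P) LeibnizatorDl LeibnizatorNl HM => Q QDl QNl HM.
  rewrite !(QDl, QNl, HM) !expand.
  (* The remaining products of two images of N come from N x . F3 (y, z, w)
     and N y . F3 (x, z, w). *)
  rewrite !(Nij_mul hN) !expand.
  abelian.
Qed.

End NijenhuisFManifold.

Theorem proposition5p5 (k : fieldType) (char0 : [pchar k] =i pred0)
  (A : lmodType k) (mul br : A -> A -> A) (N : A -> A)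
  (hA : F_manifold_algebra mul br)
  (hN : Nijenhuis_operator mul br N) :
  NS_F_manifold_algebra
    (fun x y => mul (N x) y)
    (fun x y => - N (mul x y))
    (fun x y => br (N x) y)
    (fun x y => - N (br x y)).
Proof. exact: Nijenhuis_NS_F_manifold. Qed.
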